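(* Let $\tau>0$ and let $f\colon\mathbb{R}\to\mathbb{R}$ be a function of bounded variation (on each compact interval), continuous from the right, which is either constant or periodic with minimal period $\tau$. Let $U\colon Y\to Y$ be the monodromy operator of $x(t)=f(t)x(t-\tau)$ and let $U_{\mathbb{C}}\colon Y_{\mathbb{C}}\to Y_{\mathbb{C}}$ be its complexification. Then the spectrum and the resolvent set of $U_{\mathbb{C}}$ are, respectively, $\sigma(U_{\mathbb{C}})=\overline{f(\mathbb{R})}$ and $\rho(U_{\mathbb{C}})=\mathbb{C}\setminus\overline{f(\mathbb{R})}$.
   Context: $Y:=NBV([-\tau,0];\mathbb{R})$ is the Banach space, with the total variation norm, of functions $\phi\colon[-\tau,0]\to\mathbb{R}$ of bounded variation that are continuous from the right and satisfy $\phi(0)=0$. Its complexification is $Y_{\mathbb{C}}\cong NBV([-\tau,0];\mathbb{C})$ (the same with complex values). For a function $x$ the segment of $x$ at $t$ is $x_t(\theta):=x(t+\theta)$, $\theta\in[-\tau,0]$. For $\phi\in Y$, let $x(\cdot;\phi)$ be the unique solution of the initial value problem $x(t)=f(t)x(t-\tau)$ for $t\ge 0$, $x_0=\phi$. The monodromy operator is $U\phi:=x_\tau(\cdot;\phi)$. Convention on the normalization at $0$: the initial condition prescribes $x(\theta)=\phi(\theta)$ for $\theta\in[-\tau,0)$, the equation prescribes $x(t)$ for $t\ge 0$, and segments are regarded as elements of $Y$ by assigning them the value $0$ at $\theta=0$; so $(U\phi)(\theta)=x(\tau+\theta;\phi)$ for $\theta\in[-\tau,0)$ and $(U\phi)(0)=0$.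 The complexified operator is $U_{\mathbb{C}}(\phi_{\Re}+\mathrm{i}\phi_{\Im}):=U\phi_{\Re}+\mathrm{i}U\phi_{\Im}$ for $\phi_{\Re},\phi_{\Im}\in Y$. The resolvent set $\rho(U_{\mathbb{C}})$ is the set of $\lambda\in\mathbb{C}$ such that $U_{\mathbb{C}}-\lambda I_{Y_{\mathbb{C}}}$ is bijective (with bounded inverse), and $\sigma(U_{\mathbb{C}})=\mathbb{C}\setminus\rho(U_{\mathbb{C}})$. *)

(* Defs.v *)
From HB Require Import structures.
From mathcomp Require Import all_boot all_order all_algebra.
From mathcomp Require Import all_classical all_reals all_analysis.
From mathcomp Require Import complex.
From mathcomp Require Import ring.

Set Implicit Arguments.
Unset Strict Implicit.
Unset Printing Implicit Defensive.

Import Order.TTheory GRing.Theory Num.Theory.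
Import numFieldNormedType.Exports.

Local Open Scope classical_set_scope.
Local Open Scope ring_scope.
Local Open Scope complex_scope.

(* The library's [variation], [bounded_variation] and [total_variation] are for
   functions with values in R only. Over V := R the definitions below are
   convertible to them, except that [vtotal_variation] is real valued; they
   are used over V := Rcomplex R, that is R[i] with its R-valued modulus. *)
Section vector_variation.
Context {R : realType} {V : normedZmodType R}.
Implicit Types (a b : R) (f g h : R -> V) (s : seq R).

Definition vvariation a b f s : R := let F := f \o nth b (a :: s) in
  \sum_(0 <= n < size s) `|F n.+1 - F n|.

Definition vvariations a b f := [set vvariation a b f s | s in itv_partition a b].

Definition vbounded_variation a b f := has_ubound (vvariations a b f).

Definition vtotal_variation a b f : R := sup (vvariations a b f).

Lemma vvariations_neq0 a b f : a <= b -> vvariations a b f !=set0.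
Proof.
rewrite le_eqVlt => /predU1P[->|ab].
  by exists (vvariation b b f [::]), [::].
by exists (vvariation a b f [:: b]), [:: b] => //; exact: itv_partition1.
Qed.

Lemma vvariation_le_tv a b f s : vbounded_variation a b f ->
  itv_partition a b s -> vvariation a b f s <= vtotal_variation a b f.
Proof. by move=> fbv abs; apply: ub_le_sup => //; exists s. Qed.

Lemma vtotal_variation_le a b f M : a <= b ->
  (forall s, itv_partition a b s -> vvariation a b f s <= M) ->
  vtotal_variation a b f <= M.
Proof.
move=> ab fM; apply: ge_sup; first exact: vvariations_neq0.
by move=> _ [s abs <-]; exact: fM.
Qed.

Lemma vtotal_variation_ge0 a b f : a <= b -> vbounded_variation a b f ->
  0 <= vtotal_variation a b f.
Proof.
move=> ab fbv; have [_ [s abs _]] := vvariations_neq0 f ab.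
by apply: le_trans (vvariation_le_tv fbv abs); exact: sumr_ge0.
Qed.

Lemma vvariationD a b f g s :
  vvariation a b (f \+ g) s <= vvariation a b f s + vvariation a b g s.
Proof.
rewrite /vvariation -big_split/=; apply: ler_sum => k _.
by apply: le_trans (ler_normD _ _); rewrite addrACA -opprD.
Qed.

Lemma vbounded_variationD a b f g : vbounded_variation a b f ->
  vbounded_variation a b g -> vbounded_variation a b (f \+ g).
Proof.
move=> fbv gbv; exists (vtotal_variation a b f + vtotal_variation a b g).
move=> _ [s abs <-]; apply: le_trans (vvariationD _ _ _ _ _) _.
by rewrite lerD// vvariation_le_tv.
Qed.

Lemma vtotal_variationD a b f g : a <= b -> vbounded_variation a b f ->
  vbounded_variation a b g -> vtotal_variation a b (f \+ g) <=
    vtotal_variation a b f + vtotal_variation a b g.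
Proof.
move=> ab fbv gbv; apply: vtotal_variation_le => // s abs.
apply: le_trans (vvariationD _ _ _ _ _) _.
by rewrite lerD// vvariation_le_tv.
Qed.

Lemma vtotal_variation_dist a b f x : x \in `[a, b] ->
  vbounded_variation a b f -> `|f b - f x| <= vtotal_variation a b f.
Proof.
rewrite in_itv/= => /andP[ax xb] fbv; have ab := le_trans ax xb.
move: xb; rewrite le_eqVlt => /predU1P[->|xb].
  by rewrite subrr normr0 vtotal_variation_ge0.
move: ax; rewrite le_eqVlt => /predU1P[ax|ax].
  rewrite -ax in xb *; apply: le_trans (vvariation_le_tv fbv (itv_partition1 xb)).
  by rewrite /vvariation/= big_nat1.
have abx : itv_partition a b [:: x; b] by rewrite /itv_partition/= ax xb.
apply: le_trans (vvariation_le_tv fbv abx).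
by rewrite /vvariation/= big_nat_recr//= lerDr big_nat1.
Qed.

End vector_variation.

Lemma itv_partition_nth (R : realType) (a b : R) (s : seq R) n :
  itv_partition a b s -> nth b (a :: s) n \in `[a, b].
Proof.
move=> [+ /eqP +]; elim: s a n => [|x s ih] a [|n] /=.
- by move=> _ ->; rewrite in_itv/= lexx.
- by move=> _ ->; rewrite nth_nil in_itv/= lexx.
- move=> /andP[ax xs] lb; have := ih x 0%N xs lb.
  rewrite /= !in_itv/= => /andP[_ xb].
  by rewrite lexx (le_trans (ltW ax)).
- move=> /andP[ax xs] lb; have := ih x n xs lb.
  rewrite !in_itv/= => /andP[xn ->].
  by rewrite (le_trans (ltW ax)).
Qed.

Lemma vvariation_comb (R : realType) (V1 V2 V3 : normedZmodType R)
    (a b A B : R) (f : R -> V1) (g : R -> V2) (h : R -> V3) s :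
  {in `[a, b] &, forall x y,
    `|h x - h y| <= A * `|f x - f y| + B * `|g x - g y|} ->
  itv_partition a b s ->
  vvariation a b h s <= A * vvariation a b f s + B * vvariation a b g s.
Proof.
move=> hfg abs; rewrite /vvariation !mulr_sumr -big_split/=.
apply: ler_sum => k _.
exact: (hfg _ _ (itv_partition_nth k.+1 abs) (itv_partition_nth k abs)).
Qed.

Lemma vvariation_dom (R : realType) (V1 V2 : normedZmodType R)
    (a b A : R) (f : R -> V1) (h : R -> V2) s :
  {in `[a, b] &, forall x y, `|h x - h y| <= A * `|f x - f y|} ->
  itv_partition a b s -> vvariation a b h s <= A * vvariation a b f s.
Proof.
move=> hf abs; rewrite -[leRHS]addr0 -[0 in leRHS](mul0r (vvariation a b f s)).
apply: vvariation_comb abs => x y xab yab.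
by rewrite mul0r addr0 hf.
Qed.

Lemma vbounded_variation_dom (R : realType) (V1 V2 : normedZmodType R)
    (a b A : R) (f : R -> V1) (h : R -> V2) : 0 <= A ->
  {in `[a, b] &, forall x y, `|h x - h y| <= A * `|f x - f y|} ->
  vbounded_variation a b f -> vbounded_variation a b h.
Proof.
move=> A0 hf fbv; exists (A * vtotal_variation a b f) => _ [s abs <-].
apply: le_trans (vvariation_dom hf abs) _.
by rewrite ler_wpM2l// vvariation_le_tv.
Qed.

Lemma vtotal_variationZ (R : realType) (V1 V2 : normedZmodType R)
    (a b A : R) (f : R -> V1) (h : R -> V2) : a <= b -> 0 <= A ->
  (forall x y, `|h x - h y| = A * `|f x - f y|) ->
  vbounded_variation a b f ->
  vtotal_variation a b h = A * vtotal_variation a b f.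
Proof.
move=> ab A0 hf fbv.
have hbv : vbounded_variation a b h.
  by apply: (vbounded_variation_dom A0) fbv => x y _ _; rewrite hf.
apply/eqP; rewrite eq_le; apply/andP; split.
  apply: vtotal_variation_le => // s abs.
  apply: (@le_trans _ _ (A * vvariation a b f s)).
    by apply: vvariation_dom abs => x y _ _; rewrite hf.
  by rewrite ler_wpM2l// vvariation_le_tv.
move: A0; rewrite [0 <= A]le_eqVlt => /predU1P[<-|A0].
  by rewrite mul0r vtotal_variation_ge0.
rewrite -ler_pdivlMl//; apply: vtotal_variation_le => // s abs.
apply: (@le_trans _ _ (A^-1 * vvariation a b h s)).
  by apply: vvariation_dom abs => x y _ _; rewrite hf mulKf// gt_eqF.
by rewrite ler_pM2l ?invr_gt0// vvariation_le_tv.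
Qed.

Lemma bounded_variationM (R : realType) (a b : R) (f g : R -> R) :
  bounded_variation a b f -> bounded_variation a b g ->
  bounded_variation a b (f \* g).
Proof.
move=> fbv gbv.
have bnd (h : R -> R) : bounded_variation a b h ->
    exists2 M, 0 <= M & {in `[a, b], forall x, `|h x| <= M}.
  move=> hbv; have [ab|ba] := leP a b; last first.
    by exists 0 => // x; rewrite itv_ge// -ltNge.
  exists (`|h b| + vtotal_variation a b h).
    by rewrite addr_ge0// vtotal_variation_ge0.
  move=> x xab; rewrite -[h x](subKr (h b)).
  apply: le_trans (ler_normB _ _) _.
  by rewrite lerD2l vtotal_variation_dist.
have [A A0 fA] := bnd f fbv; have [B B0 gB] := bnd g gbv.
exists (A * vtotal_variation a b g + B * vtotal_variation a b f).
move=> _ [s abs <-].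
apply: (@le_trans _ _ (A * vvariation a b g s + B * vvariation a b f s)).
  apply: (@vvariation_comb R R R R _ _ A B g f) abs => x y xab yab /=.
  have -> : f x * g x - f y * g y = f x * (g x - g y) + g y * (f x - f y).
    by ring.
  apply: le_trans (ler_normD _ _) _.
  by rewrite !normrM lerD// ler_wpM2r// ?fA ?gB.
by rewrite lerD// ler_wpM2l// vvariation_le_tv.
Qed.

Lemma bounded_variation_shift (R : realType) (a b c : R) (f : R -> R) :
  bounded_variation (c + a) (c + b) f ->
  bounded_variation a b (fun x => f (c + x)).
Proof.
move=> [M fM]; exists M => _ [s [abs /eqP sb] <-].
apply: fM; exists [seq c + x | x <- s].
  split; last by rewrite last_map sb.
  rewrite (homo_path _ abs)// => x y; by rewrite ltrD2l.
rewrite /variation size_map !big_nat; apply: eq_bigr => i /andP[_ is_].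
rewrite /= -!(@nth_map _ b _ (c + b) (fun x => c + x)) /= ?ltnS ?(ltnW is_)//.
Qed.

(* The space NBV([-tau, 0]; R).  A function on [-tau, 0] is represented by its
   extension by 0 to R; the extension plays no role in the variation on
   [-tau, 0], nor in right limits at the points of [-tau, 0[. *)
Section real_NBV.
Context {R : realType} (tau : {posnum R}).
Local Notation T := (tau%:num).

Record is_nbv (phi : R -> R) : Prop := IsNBV {
  nbv_out : forall theta, theta \notin `[- T, 0] -> phi theta = 0 ;
  nbv_0 : phi 0 = 0 ;
  nbv_bv : bounded_variation (- T) 0 phi ;
  nbv_rcont : forall theta, theta \in `[- T, 0[ ->
    phi x @[x --> theta^'+] --> phi theta }.

Definition nbv_pred : {pred R -> R} := fun phi => `[< is_nbv phi >].

Record NBV := MkNBV { nbv_fun :> R -> R ; _ : nbv_fun \in nbv_pred }.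

HB.instance Definition _ := [isSub for nbv_fun].
HB.instance Definition _ := [Choice of NBV by <:].

Lemma is_nbvP (phi : NBV) : is_nbv phi.
Proof. by case: phi => phi /= /asboolP. Qed.

Definition to_nbv (phi : R -> R) (p : is_nbv phi) : NBV := MkNBV (asboolT p).

Lemma nbv_ext (phi psi : NBV) : phi =1 psi -> phi = psi.
Proof. by move=> eq; apply: val_inj; apply/funext. Qed.

Lemma oppT_le0 : - T <= 0 :> R. Proof. by rewrite oppr_le0. Qed.

Lemma nbv_submod_closed : submod_closed nbv_pred.
Proof.
split.
  apply/asboolP; split=> //.
    by exists 0 => _ [s _ <-]; rewrite /variation big1// => i _; rewrite subrr normr0.
  by move=> theta _; exact: cvg_cst.
move=> c f g /asboolP[f_out f0 fbv frc] /asboolP[g_out g0 gbv grc].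
apply/asboolP; split.
- by move=> theta th; rewrite /= !fctE f_out// g_out// scaler0 addr0.
- by rewrite !fctE f0 g0 scaler0 addr0.
- apply: (@vbounded_variationD R R) => //.
  apply: (vbounded_variation_dom (normr_ge0 c)) fbv => x y _ _.
  by rewrite !fctE -scalerBr normrZ.
- move=> theta th; apply: cvgD; last exact: grc.
  by apply: cvgZl_tmp; exact: frc.
Qed.

HB.instance Definition _ := GRing.isSubmodClosed.Build R (R -> R) nbv_pred
  nbv_submod_closed.
HB.instance Definition _ := [SubChoice_isSubLmodule of NBV by <:].

Definition nbv_norm (phi : NBV) : R := fine (total_variation (- T) 0 phi).

Lemma nbv_normE (phi : NBV) :
  nbv_norm phi = @vtotal_variation R R (- T) 0 phi.
Proof.
rewrite /nbv_norm /total_variation ereal_sup_EFin//.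
  exact: (nbv_bv (is_nbvP phi)).
exact: (@vvariations_neq0 R R) oppT_le0.
Qed.

Lemma nbv_normD (phi psi : NBV) :
  nbv_norm (phi + psi) <= nbv_norm phi + nbv_norm psi.
Proof.
rewrite !nbv_normE; apply: (@vtotal_variationD R R) oppT_le0 _ _.
  exact: (nbv_bv (is_nbvP phi)).
exact: (nbv_bv (is_nbvP psi)).
Qed.

Lemma nbv_normZ (c : R) (phi : NBV) : nbv_norm (c *: phi) = `|c| * nbv_norm phi.
Proof.
rewrite !nbv_normE; apply: vtotal_variationZ => //.
- by move=> x y; rewrite -normrM mulrBr.
- exact: (nbv_bv (is_nbvP phi)).
Qed.

Lemma nbv_norm_eq0 (phi : NBV) : nbv_norm phi = 0 -> phi = 0.
Proof.
rewrite nbv_normE => phi0; apply: nbv_ext => x /=.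
have [xT|/(nbv_out (is_nbvP phi)) ->//] := boolP (x \in `[- T, 0]).
have := @vtotal_variation_dist R R _ _ _ _ xT (nbv_bv (is_nbvP phi)).
rewrite phi0 (nbv_0 (is_nbvP phi)) sub0r normrN normr_le0 => /eqP ->//.
Qed.

HB.instance Definition _ := Lmodule_isNormed.Build R NBV
  nbv_normD nbv_normZ nbv_norm_eq0.

End real_NBV.

(* The space NBV([-tau, 0]; C), with the same representation. *)
Section complex_NBV.
Context {R : realType} (tau : {posnum R}).
Local Notation T := (tau%:num).

Record is_nbvc (phi : R -> R[i]) : Prop := IsNBVC {
  nbvc_out : forall theta, theta \notin `[- T, 0] -> phi theta = 0 ;
  nbvc_0 : phi 0 = 0 ;
  nbvc_bv : vbounded_variation (V := Rcomplex R) (- T) 0 phi ;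
  nbvc_rcont : forall theta, theta \in `[- T, 0[ ->
    (phi x : R[i]^o) @[x --> theta^'+] --> (phi theta : R[i]^o) }.

Definition nbvc_pred : {pred R -> R[i]} := fun phi => `[< is_nbvc phi >].

Record NBVC := MkNBVC { nbvc_fun :> R -> R[i] ; _ : nbvc_fun \in nbvc_pred }.

HB.instance Definition _ := [isSub for nbvc_fun].
HB.instance Definition _ := [Choice of NBVC by <:].

Lemma is_nbvcP (phi : NBVC) : is_nbvc phi.
Proof. by case: phi => phi /= /asboolP. Qed.

Definition to_nbvc (phi : R -> R[i]) (p : is_nbvc phi) : NBVC :=
  MkNBVC (asboolT p).

Lemma nbvc_ext (phi psi : NBVC) : phi =1 psi -> phi = psi.
Proof. by move=> eq; apply: val_inj; apply/funext. Qed.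

Lemma nbvc_submod_closed : submod_closed nbvc_pred.
Proof.
split.
  apply/asboolP; split=> //.
    by exists 0 => _ [s _ <-]; rewrite /vvariation big1// => i _; rewrite subrr normr0.
  by move=> theta _; exact: cvg_cst.
move=> c f g /asboolP[f_out f0 fbv frc] /asboolP[g_out g0 gbv grc].
apply/asboolP; split.
- by move=> theta th; rewrite /= !fctE f_out// g_out// scaler0 addr0.
- by rewrite !fctE f0 g0 scaler0 addr0.
- apply: (@vbounded_variationD R (Rcomplex R)) => //.
  apply: (@vbounded_variation_dom R (Rcomplex R) (Rcomplex R) _ _
    (Normc.normc c) f) fbv; first by case: (c) => ? ?; exact: sqrtr_ge0.
  move=> x y _ _; rewrite !fctE.
  rewrite -[leRHS](Normc.normcM c (f x - f y)) mulrBr.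
  exact: lexx.
- move=> theta th.
  have FF : Filter (theta : R)^'+ by typeclasses eauto.
  have cf := @cvgZl_tmp R[i] R[i]^o R _ FF c _ _ (frc _ th).
  exact: (@cvgD R[i] R[i]^o R _ FF _ _ _ _ cf (grc _ th)).
Qed.

HB.instance Definition _ := GRing.isSubmodClosed.Build R[i] (R -> R[i])
  nbvc_pred nbvc_submod_closed.
HB.instance Definition _ := [SubChoice_isSubLmodule of NBVC by <:].

(* The norm of a normed module over R[i] takes its values in R[i]. *)
Definition nbvc_norm (phi : NBVC) : R[i] :=
  (vtotal_variation (V := Rcomplex R) (- T) 0 phi)%:C.

Lemma nbvc_normD (phi psi : NBVC) :
  nbvc_norm (phi + psi) <= nbvc_norm phi + nbvc_norm psi.
Proof.
rewrite /nbvc_norm -rmorphD lecR.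
apply: (@vtotal_variationD R (Rcomplex R)) (oppT_le0 tau) _ _.
  exact: (nbvc_bv (is_nbvcP phi)).
exact: (nbvc_bv (is_nbvcP psi)).
Qed.

Lemma nbvc_normZ (c : R[i]) (phi : NBVC) :
  nbvc_norm (c *: phi) = `|c| * nbvc_norm phi.
Proof.
rewrite /nbvc_norm -[`|c|]/((Normc.normc c)%:C) -rmorphM; congr (_%:C).
apply: vtotal_variationZ.
- exact: oppT_le0.
- by case: (c) => ? ?; exact: sqrtr_ge0.
- by move=> x y; rewrite -[RHS](Normc.normcM c (phi x - phi y)) mulrBr.
- exact: (nbvc_bv (is_nbvcP phi)).
Qed.

Lemma nbvc_norm_eq0 (phi : NBVC) : nbvc_norm phi = 0 -> phi = 0.
Proof.
move=> [phi0]; apply: nbvc_ext => x /=.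
have [xT|/(nbvc_out (is_nbvcP phi)) ->//] := boolP (x \in `[- T, 0]).
have := @vtotal_variation_dist R (Rcomplex R) _ _ _ _ xT
  (nbvc_bv (is_nbvcP phi)).
rewrite phi0 (nbvc_0 (is_nbvcP phi)) sub0r normrN normr_le0 => /eqP ->//.
Qed.

HB.instance Definition _ := Lmodule_isNormed.Build R[i] NBVC
  nbvc_normD nbvc_normZ nbvc_norm_eq0.

End complex_NBV.

Section complexification.
Context {R : realType} (tau : {posnum R}).
Local Notation T := (tau%:num).
Local Notation Y := (NBV tau).
Local Notation YC := (NBVC tau).

Lemma is_nbvc_real (phi : Y) : is_nbvc tau (fun theta => (phi theta)%:C).
Proof.
have [po p0 pbv prc] := is_nbvP phi; split.
- by move=> theta /po ->.
- by rewrite p0.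
- apply: (@vbounded_variation_dom R R (Rcomplex R) _ _ 1 phi) pbv => //.
  move=> x y _ _; rewrite mul1r -rmorphB.
  by rewrite /Num.norm /= expr0n addr0 sqrtr_sqr.
- move=> theta /prc /cvgrPdist_lt h; apply/cvgrPdist_lt => /= e e0.
  have e0' : 0 < complex.Re e by move: e0; rewrite ltcE => /andP[].
  have eE : e = (complex.Re e)%:C.
    by case: (e) e0 => a b; rewrite ltcE /= => /andP[/eqP -> _].
  have := h _ e0'; apply: filterS => x.
  rewrite -rmorphB normc_def /= expr0n addr0 sqrtr_sqr => hx.
  by rewrite eE ltcR.
Qed.

Definition nbv_complex (phi : Y) : YC := to_nbvc (is_nbvc_real phi).

Lemma is_nbv_Re (phi : YC) : is_nbv tau (fun theta => complex.Re (phi theta)).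
Proof.
have [po p0 pbv prc] := is_nbvcP phi; split.
- by move=> theta /po ->.
- by rewrite p0.
- apply: (@vbounded_variation_dom R (Rcomplex R) R _ _ 1 phi) pbv => //.
  move=> x y _ _; rewrite mul1r -raddfB -lecR.
  exact: (normc_ge_Re (phi x - phi y)).
- move=> theta /prc /cvgrPdist_lt h; apply/cvgrPdist_lt => /= e e0.
  have := h e%:C; rewrite ltcR => /(_ e0); apply: filterS => x hx.
  rewrite -raddfB -ltcR; apply: le_lt_trans hx.
  exact: normc_ge_Re.
Qed.

Lemma is_nbv_Im (phi : YC) : is_nbv tau (fun theta => complex.Im (phi theta)).
Proof.
have nI (z : R[i]) : `|complex.Im z|%:C <= `|z|.
  rewrite normc_def lecR -sqrtr_sqr ler_wsqrtr// lerDr.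
  exact: sqr_ge0.
have [po p0 pbv prc] := is_nbvcP phi; split.
- by move=> theta /po ->.
- by rewrite p0.
- apply: (@vbounded_variation_dom R (Rcomplex R) R _ _ 1 phi) pbv => //.
  move=> x y _ _; rewrite mul1r -raddfB -lecR.
  exact: (nI (phi x - phi y)).
- move=> theta /prc /cvgrPdist_lt h; apply/cvgrPdist_lt => /= e e0.
  have := h e%:C; rewrite ltcR => /(_ e0); apply: filterS => x hx.
  rewrite -raddfB -ltcR; apply: le_lt_trans hx.
  exact: nI.
Qed.

Definition nbv_Re (phi : YC) : Y := to_nbv (is_nbv_Re phi).
Definition nbv_Im (phi : YC) : Y := to_nbv (is_nbv_Im phi).

Definition complexify (U : Y -> Y) (phi : YC) : YC :=
  nbv_complex (U (nbv_Re phi)) + 'i *: nbv_complex (U (nbv_Im phi)).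

Lemma complexify_id : complexify id = id.
Proof.
apply/funext => phi; apply: nbvc_ext => x /=.
by rewrite [RHS]complexE.
Qed.

End complexification.

Section monodromy.
Context {R : realType} (tau : {posnum R}) (f : R -> R).
Local Notation T := (tau%:num).
Local Notation Y := (NBV tau).

(* The segment x_t, extended by 0 off [-tau, 0] and with value 0 at 0. *)
Definition segment (x : R -> R) (t : R) : R -> R :=
  fun theta => if theta \in `[- T, 0[ then x (t + theta) else 0.

(* x(.; phi) is a function on [-tau, +oo[; here it is extended by 0. *)
Record is_solution (phi : Y) (x : R -> R) : Prop := IsSolution {
  solution_out : forall t, t < - T -> x t = 0 ;
  solution_init : segment x 0 = phi ;
  solution_eq : forall t, 0 <= t -> x t = f t * x (t - T) }.

Lemma is_solution_uniq (phi : Y) (x y : R -> R) :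
  is_solution phi x -> is_solution phi y -> x = y.
Proof.
move=> [xo xi xe] [yo yi ye]; apply/funext => t.
have neg s : s < 0 -> x s = y s.
  move=> s0; have [sT|Ts] := ltP s (- T); first by rewrite xo// yo.
  have := congr1 (@^~ s) (etrans xi (esym yi)).
  by rewrite /segment in_itv/= Ts s0 !add0r.
suff H n s : s < n%:R * T -> x s = y s.
  apply: (H (Num.truncn (t / T)).+1).
  by rewrite -ltr_pdivrMr// truncnS_gt.
elim: n s => [|n ih] s; first by rewrite mul0r => /neg.
move=> sn; have [s0|/neg//] := leP 0 s.
rewrite xe// ye// ih//.
by rewrite ltrBlDr -[X in _ + X]mul1r -mulrDl natr1.
Qed.

Fixpoint solution_iter (phi : R -> R) (n : nat) (t : R) : R :=
  if t < 0 then phi t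
  else if n is m.+1 then f t * solution_iter phi m (t - T) else 0.

Lemma is_solution_exists (phi : Y) : exists x, is_solution phi x.
Proof.
pose N (t : R) := (Num.truncn (t / T)).+1.
have stab n m t : t < n%:R * T -> t < m%:R * T ->
    solution_iter phi n t = solution_iter phi m t.
  elim: n m t => [|n ih] [|m] t //=; rewrite ?mul0r.
  - by move=> ->.
  - by move=> _ ->.
  - move=> tn tm; case: ifPn => // _; rewrite (ih m)//.
      by rewrite ltrBlDr -[X in _ + X]mul1r -mulrDl natr1.
    by rewrite ltrBlDr -[X in _ + X]mul1r -mulrDl natr1.
have NP t : t < (N t)%:R * T by rewrite -ltr_pdivrMr// truncnS_gt.
have [po p0 _ _] := is_nbvP phi.
exists (fun t => solution_iter phi (N t) t); split.
- move=> t tT /=; rewrite (lt_trans tT) ?oppr_lt0//.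
  by apply: po; rewrite in_itv/= leNgt tT.
- apply/funext => theta; rewrite /segment add0r.
  case: ifPn => [|th]; first by rewrite in_itv/= => /andP[_ ->].
  have [->//|th0] := eqVneq theta 0.
  apply/esym/po; apply: contra th; rewrite !in_itv/= => /andP[-> +].
  by rewrite lt_neqAle th0.
- move=> t t0.
  have -> : solution_iter phi (N t) t =
      f t * solution_iter phi (Num.truncn (t / T)) (t - T).
    by rewrite /N /= ltNge t0.
  rewrite (stab _ (N (t - T)))// ltrBlDr -[X in _ + X]mul1r -mulrDl natr1.
  exact: NP.
Qed.

Definition solution (phi : Y) : R -> R := sval (cid (is_solution_exists phi)).

Lemma solutionP (phi : Y) : is_solution phi (solution phi).
Proof. exact: svalP. Qed.

Lemma segment_solution (phi : Y) theta :
  segment (solution phi) T theta = f (T + theta) * phi theta.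
Proof.
have [_ xi xe] := solutionP phi.
rewrite -xi /segment; case: ifPn; last by rewrite mulr0.
rewrite in_itv/= => /andP[Tth _]; rewrite xe -?lerBlDl ?sub0r//.
by rewrite add0r addrAC subrr add0r.
Qed.

Context (f_bv : forall a b, a <= b -> bounded_variation a b f)
  (f_rcont : forall t, f x @[x --> t^'+] --> f t).

Lemma is_nbv_segment (phi : Y) : is_nbv tau (segment (solution phi) T).
Proof.
have -> : segment (solution phi) T = (fun theta => f (T + theta)) \* phi.
  by apply/funext => theta; rewrite segment_solution.
have [po p0 pbv prc] := is_nbvP phi; split.
- by move=> theta /po /= ->; rewrite mulr0.
- by rewrite /= p0 mulr0.
- apply: bounded_variationM => //; apply: bounded_variation_shift.
  by apply: f_bv; rewrite lerD2l oppT_le0.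
- move=> theta th; apply: cvgM; last exact: prc.
  apply/cvgrPdist_lt => e e0; have /cvgrPdist_lt/(_ e e0) := @f_rcont (T + theta).
  move=> [d /= d0 dP]; exists d => //= x /= dx thx.
  apply: dP; last by rewrite ltrD2l.
  by rewrite /= opprD addrACA subrr add0r.
Qed.

Definition monodromy (phi : Y) : Y := to_nbv (is_nbv_segment phi).

End monodromy.

Arguments segment {R} tau x t.
Arguments is_solution {R} tau f phi x.
Arguments solution {R} tau f phi.
Arguments monodromy {R} tau {f} f_bv f_rcont phi.

Section spectrum.
Context {K : numFieldType} {X : normedModType K}.
Implicit Types A : X -> X.

Definition resolvent_set A : set K := [set l | exists B : X -> X,
  [/\ cancel (fun x => A x - l *: x) B, cancel B (fun x => A x - l *: x) &
      exists M : K, forall y, `|B y| <= M * `|y| ] ].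

Definition spectrum A : set K := ~` resolvent_set A.

End spectrum.

Definition has_minimal_period (R : realType) (f : R -> R) (p : R) : Prop :=
  [/\ 0 < p, forall t, f (t + p) = f t &
      forall q, 0 < q -> q < p -> ~ (forall t, f (t + q) = f t)].

(* Main.v *)
(* By periodicity U_C is multiplication by f.  If f - l is bounded away from 0
   then 1 / (f - l) is of bounded variation and right continuous, and
   multiplication by it is the bounded inverse of U_C - l.  Conversely, if
   U_C - l is onto, the preimage of the indicator of [-tau, 0[ is 1 / (f - l);
   being of bounded variation it is bounded, so f - l is bounded away from 0. *)
Require Import Defs.
From mathcomp Require Import all_boot all_order all_algebra.
From mathcomp Require Import all_classical all_reals all_analysis.
From mathcomp Require Import complex.

Import Order.TTheory GRing.Theory Num.Theory.
Import numFieldNormedType.Exports.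

Local Open Scope classical_set_scope.
Local Open Scope ring_scope.
Local Open Scope complex_scope.

(** * Translation by periods *)

Lemma periodic_reduce (R : realType) (p : R) (f : R -> R) (t : R) : 0 < p ->
  (forall u, f (u + p) = f u) -> exists2 s, s \in `[- p, 0[ & f s = f t.
Proof.
move=> p0 fp.
have fz (m : int) u : f (u + m%:~R * p) = f u.
  case: m => n; rewrite ?NegzE ?mulrNz ?mulNr -?pmulrn mulr_natl.
    exact: periodicn.
  by rewrite -[LHS](periodicn fp n.+1) subrK.
(* Translating by [floor (t / p)] periods would land in [[0, p[]; one further period lands in [[- p,
   0[], where segments live. *)
exists (t + (- (Num.floor (t / p) + 1))%:~R * p); last exact: fz.
have /andP[lt gt] := floor_itv (t / p).
rewrite in_itv/= mulrNz mulNr subr_lt0 -ltr_pdivrMr// gt andbT.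
by rewrite intrD mulrDl mul1r opprD addrA lerDr subr_ge0 -ler_pdivlMr.
Qed.

(** * Real radii and the complex modulus *)

Section complex_values.
Context {R : realType}.
Import Normc.

Lemma gt0_complexE (e : R[i]) : 0 < e -> exists2 r : R, 0 < r & e = r%:C.
Proof. by case: e => a b; rewrite ltcE /= => /andP[/eqP -> ?]; exists a. Qed.

(** Balls of [R[i]^o] have radii in [R[i]], but a positive complex number is a positive real, so
    real radii suffice. *)
Lemma closure_real_imageP (f : R -> R) (l : R[i]) :
  closure [set ((f t)%:C : R[i]^o) | t in [set: R]] (l : R[i]^o) <->
  forall e : R, 0 < e -> exists t, normc ((f t)%:C - l) < e.
Proof.
split=> [cl e e0|H B /nbhs_ballP[e /= e0 eB]].
- have e0' : 0 < e%:C by rewrite ltcR.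
  have [_ [[t _ <-]]] := cl _ (nbhsx_ballx (l : R[i]^o) _ e0').
  by rewrite -ball_normE/= distrC ltcR => te; exists t.
- have [r r0 eE] := gt0_complexE _ e0.
  have [t te] := H _ r0; exists ((f t)%:C); split; first by exists t.
  by apply: eB; rewrite -ball_normE/= distrC eE ltcR.
Qed.

Lemma cvg_real_complex (F : set_system R) (FF : Filter F) (f : R -> R) (l : R) :
  f x @[x --> F] --> l -> ((f x)%:C : R[i]^o) @[x --> F] --> (l%:C : R[i]^o).
Proof.
move=> /cvgrPdist_lt h; apply/cvgrPdist_lt => /= e e0.
have [r r0 ->] := gt0_complexE _ e0.
have := h _ r0; apply: filterS => x.
by rewrite -rmorphB normc_def /= expr0n addr0 sqrtr_sqr ltcR.
Qed.

Lemma normc_real (x : R) : normc x%:C = `|x|.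
Proof. by rewrite /= expr0n addr0 sqrtr_sqr. Qed.

Lemma normc_ge0 (z : R[i]) : 0 <= normc z.
Proof. exact: (normr_ge0 (z : Rcomplex R)). Qed.

End complex_values.

(** * The monodromy operator as a multiplication operator *)

Section multiplication.
Context {R : realType} (tau : {posnum R}) (f : R -> R).
Context (f_bv : forall a b : R, a <= b -> bounded_variation a b f)
  (f_rcont : forall t : R, f x @[x --> t^'+] --> f t).
Local Notation T := (tau%:num).
Local Notation UC := (complexify (monodromy tau f_bv f_rcont)).
Import Normc.

(** On [[0, tau[] the solution is [f] times the shifted initial function, and a real factor acts
    alike on real and imaginary parts. *)
Lemma complexify_monodromyE (phi : NBVC tau) theta :
  UC phi theta = (f (T + theta))%:C * phi theta.
Proof.
rewrite -[LHS]/((segment tau (solution tau f (nbv_Re phi)) T theta)%:C +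
  'i * (segment tau (solution tau f (nbv_Im phi)) T theta)%:C).
rewrite !segment_solution [in RHS](complexE (phi theta)).
by rewrite mulrDr !rmorphM [X in _ = _ + X]mulrCA.
Qed.

Hypothesis f_per : forall t, f (t + T) = f t.

(** Periodicity turns the factor [f (T + theta)] into [f theta]. *)
Lemma resolvent_multE (l : R[i]) (phi : NBVC tau) theta :
  (UC phi - l *: phi) theta = ((f theta)%:C - l) * phi theta.
Proof.
rewrite mulrBl -(f_per theta) (addrC theta) -complexify_monodromyE.
by [].
Qed.

(** This indicator stands in for the constant 1, which the normalization at 0 excludes from the
    space. *)
Lemma is_nbv_step : is_nbv tau (fun x => ((x \in `[- T, 0[) : nat)%:R : R).
Proof.
split.
- move=> x xT; suff /negPf -> : x \notin `[- T, 0[ by [].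
  by apply: contra xT; rewrite !in_itv/= => /andP[-> /ltW].
- by rewrite in_itv/= ltxx andbF.
- apply/(bounded_variationP _ (oppT_le0 tau)).
  (* The step is nonincreasing on [[- T, 0]], so the monotone case applies to its negative. *)
  rewrite -total_variationN (nondecreasing_total_variation (oppT_le0 tau))//.
  move=> x y; rewrite !in_itv/= => /andP[xT _] /andP[yT _] xy.
  rewrite /= !in_itv/= xT yT /=.
  rewrite lerN2 ler_nat; case: (ltP y 0) => // y0.
  by rewrite (le_lt_trans xy).
- move=> x; rewrite in_itv/= => /andP[xT x0].
  rewrite xT x0/=.
  apply: cvg_near_cst; near=> y.
  have yT : - T <= y by apply: (le_trans xT); near: y; exact: nbhs_right_ge.
  have y0 : y < 0 by near: y; exact: nbhs_right_lt.
  by rewrite in_itv/= yT y0.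
Unshelve. all: by end_near. Qed.

Lemma resolvent_notin_closure (l : R[i]) : resolvent_set UC l ->
  ~ closure [set ((f t)%:C : R[i]^o) | t in [set: R]] (l : R[i]^o).
Proof.
move=> [B [_ BK _]] /closure_real_imageP cl.
pose one := nbv_complex (to_nbv is_nbv_step).
set K := vtotal_variation (V := Rcomplex R) (- T) 0 (B one).
have Bbv := nbvc_bv (is_nbvcP (B one)).
have K0 : 0 <= K by apply: vtotal_variation_ge0 Bbv; exact: oppT_le0.
(* [K] will bound the modulus of [B one]; adding 1 keeps the radius positive even for [K = 0]. *)
have [] := cl (K + 1)^-1; first by rewrite invr_gt0 ltr_wpDl.
move=> t; have [s sT <-] := periodic_reduce _ _ f t (gt0 tau) f_per.
have sT' : s \in `[- T, 0].
  by move: sT; rewrite !in_itv/= => /andP[-> /ltW].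
have fB : ((f s)%:C - l) * B one s = one s.
  rewrite -resolvent_multE.
  exact: (congr1 (fun phi : NBVC tau => phi s) (BK one)).
have {}fB : normc ((f s)%:C - l) * normc (B one s) = 1.
  by rewrite -normcM fB -normc1 /= sT.
have BK' : normc (B one s) <= K.
  have := vtotal_variation_dist sT' Bbv.
  by rewrite (nbvc_0 (is_nbvcP (B one))) sub0r normrN.
(* The product in [fB], equal to 1, is at most [normc ((f s)%:C - l)] times [K + 1], against the
   choice of the radius. *)
rewrite -[_^-1]mul1r ltr_pdivlMr ?ltr_wpDl// ltNge -fB => /negP; apply.
rewrite ler_wpM2l ?normc_ge0//.
by rewrite (le_trans BK')// fB lerDl.
Qed.

(** * The bounded inverse: multiplication by [1 / (f - l)] *)

Section inverse.
Context (l : R[i]) (d : R) (d0 : 0 < d).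
Hypothesis fd : forall t, d <= normc ((f t)%:C - l).
Let g t := ((f t)%:C - l)^-1.

Let fl_neq0 t : (f t)%:C - l != 0.
Proof.
by apply: contraTneq (fd t) => ->; rewrite normc0 -ltNge.
Qed.

Let normc_g t : normc (g t) <= d^-1.
Proof. by rewrite normcV lef_pV2 ?posrE// (lt_le_trans d0). Qed.

Let normc_gB x y : normc (g x - g y) <= d^-1 ^+ 2 * `|f x - f y|.
Proof.
(* The identity [1/u - 1/v = (v - u)/(u v)]; both reciprocals have modulus at most [1 / d]. *)
have -> : g x - g y = (f y - f x)%:C * (g x * g y).
  have -> : (f y - f x)%:C = ((f y)%:C - l) - ((f x)%:C - l).
    by rewrite opprB addrA subrK rmorphB.
  by rewrite mulrBl mulrCA mulfV// mulr1 mulrA mulfV// mul1r.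
rewrite !normcM normc_real distrC mulrC ler_wpM2r// expr2.
by rewrite ler_pM ?normc_ge0.
Qed.

(** Product rule for increments; since [phi 0 = 0], the total variation of [phi] bounds [phi y]. *)
Let normc_gMB (phi : NBVC tau) :
  {in `[- T, 0] &, forall x y, `|g x * phi x - g y * phi y : Rcomplex R| <=
    d^-1 * `|phi x - phi y : Rcomplex R| +
    d^-1 ^+ 2 * vtotal_variation (V := Rcomplex R) (- T) 0 phi *
    `|f x - f y| }.
Proof.
move=> x y xT yT.
have -> : g x * phi x - g y * phi y =
    g x * (phi x - phi y) + (g x - g y) * phi y.
  by rewrite mulrBr mulrBl addrA subrK.
apply: le_trans (le_normcD _ _) _; rewrite !normcM.
apply: lerD.
  by rewrite ler_wpM2r ?normc_ge0.
rewrite mulrAC ler_pM ?normc_ge0//.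
have := vtotal_variation_dist yT (nbvc_bv (is_nbvcP phi)).
by rewrite (nbvc_0 (is_nbvcP phi)) sub0r normrN.
Qed.

(** A bound uniform in [s] and linear in the variation of [phi] gives both that the product stays in
    the space and that the inverse is bounded. *)
Let variation_gM (phi : NBVC tau) s : itv_partition (- T) 0 s ->
  vvariation (V := Rcomplex R) (- T) 0 (g \* phi) s <=
  (d^-1 + d^-1 ^+ 2 * @vtotal_variation R R (- T) 0 f) *
  vtotal_variation (V := Rcomplex R) (- T) 0 phi.
Proof.
move=> sT; have T0 := oppT_le0 tau.
apply: le_trans.
  exact: (vvariation_comb (normc_gMB phi) sT).
have pbv := nbvc_bv (is_nbvcP phi).
have dV0 : 0 <= d^-1 by rewrite invr_ge0 ltW.
rewrite mulrDl [X in _ <= _ + X]mulrAC lerD//.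
  by rewrite ler_wpM2l// vvariation_le_tv.
rewrite ler_wpM2l ?mulr_ge0 ?vtotal_variation_ge0//.
by rewrite vvariation_le_tv//; exact: f_bv.
Qed.

Let is_nbvc_gM (phi : NBVC tau) : is_nbvc tau (g \* phi).
Proof.
have [po p0 pbv prc] := is_nbvcP phi; split.
- by move=> x /po /= ->; rewrite mulr0.
- by rewrite /= p0 mulr0.
- by eexists => _ [s sT <-]; exact: variation_gM.
- move=> x xT.
  have FF : Filter (x : R)^'+ by typeclasses eauto.
  have cf := cvg_real_complex _ FF _ _ (f_rcont x).
  have cfl := @cvgB R[i] R[i]^o R _ FF _ _ _ _ cf (cvg_cst (l : R[i]^o)).
  have cg := @cvgV R[i] R _ FF _ _ (fl_neq0 x) (cfl FF).
  exact: (@cvgM R[i] R _ FF _ _ _ _ cg (prc _ xT)).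
Qed.

Lemma resolvent_set_away : resolvent_set UC l.
Proof.
exists (fun phi => to_nbvc (is_nbvc_gM phi)); split.
- move=> phi; apply: nbvc_ext => x.
  rewrite -[LHS]/(g x * (UC phi - l *: phi) x) resolvent_multE.
  exact: mulKf.
- move=> phi; apply: nbvc_ext => x.
  by rewrite (resolvent_multE l (to_nbvc (is_nbvc_gM phi))); exact: mulVKf.
- exists (d^-1 + d^-1 ^+ 2 * @vtotal_variation R R (- T) 0 f)%:C => phi.
  rewrite -[`|phi|]/(nbvc_norm phi) /nbvc_norm -rmorphM /=.
  rewrite [leLHS]/Num.norm/= /nbvc_norm lecR.
  apply: vtotal_variation_le; first exact: oppT_le0.
  exact: variation_gM.
Qed.

End inverse.

Lemma resolvent_setE :
  resolvent_set UC = ~` closure [set ((f t)%:C : R[i]^o) | t in [set: R]].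
Proof.
apply/seteqP; split=> l; first exact: resolvent_notin_closure.
move=> ncl; apply: contrapT => nl; apply: ncl.
(* If no value of [f] came within [e] of [l], then [e] would serve as the lower bound [d] and [l]
   would be in the resolvent set. *)
apply/closure_real_imageP => e e0; apply: contrapT => nt; apply: nl.
apply: (resolvent_set_away _ _ e0) => t.
by rewrite leNgt; apply/negP => te; apply: nt; exists t.
Qed.

End multiplication.

Theorem theorem3 (R : realType) (tau : {posnum R}) (f : R -> R)
    (f_bv : forall a b : R, a <= b -> bounded_variation a b f)
    (f_rcont : forall t : R, f x @[x --> t^'+] --> f t)
    (f_per : (exists c : R, forall t : R, f t = c) \/
             has_minimal_period f tau%:num) :
  let UC : NBVC tau -> NBVC tau := complexify (monodromy tau f_bv f_rcont) in
  let clf : set R[i]^o := closure [set ((f t)%:C : R[i]^o) | t in [set: R]] in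
  spectrum UC = clf /\ resolvent_set UC = ~` clf.
Proof.
move=> UC clf.
(* A constant function also has period [tau], so both alternatives give the same periodicity. *)
have fT t : f (t + tau%:num) = f t.
  by case: f_per => [[c fc]|[]//]; rewrite !fc.
have UCE : resolvent_set UC = ~` clf by exact: resolvent_setE.
by split=> //; rewrite /spectrum UCE setCK.
Qed.
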